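(* Let $(R,\mathfrak m)$ be a Cohen-Macaulay local ring of dimension two with infinite residue field and let $I,J$ be $\mathfrak m$-primary ideals of $R$. Let $r_0,s_0\ge0$ be integers. Assume that $(a,b)$ is a joint reduction of $I$ and $J$ such that $$(a)\cap I^{r_0+k}J^{s_0}=aI^{r_0+k-1}J^{s_0}\quad\text{and}\quad (b)\cap I^{r_0}J^{s_0+k}=bI^{r_0}J^{s_0+k-1}\quad\text{for all }k\ge1.$$ Then the following statements are equivalent: (a) $(r_0,s_0)\in\Lambda(I|J)$; (b) $e_{(0,1)}=g_1(r_0)+r_0e_{(1,1)}$, $e_{(1,0)}=h_1(s_0)+s_0e_{(1,1)}$ and $$e_2(IJ)=g_2(r_0)+h_2(s_0)-\ell(R/I^{r_0}J^{s_0})+r_0s_0e_{(1,1)}+\ell\left(\frac{\widetilde{\mathcal F}_{(a,b)}(I^{r_0},J^{s_0})}{I^{r_0}J^{s_0}}\right);$$ (c) $M^1_{r_0,s_0}(a^k,b^k)=0$ for all $k\ge1$.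
   Context: $\ell$ denotes length of $R$-modules, and $I^0=J^0=R$. A pair $(a,b)$ is a joint reduction of $I$ and $J$ if $a\in I$, $b\in J$ and $I^{r+1}J^{s+1}=aI^rJ^{s+1}+bI^{r+1}J^s$ for all large $r,s$. The joint reduction lattice is $\Lambda(I|J):=\{(r,s)\in\mathbb N^2: I^{r+1}J^{s+1}=a'I^rJ^{s+1}+b'I^{r+1}J^s\text{ for some joint reduction }(a',b')\text{ of }I\text{ and }J\}$ (with $0\in\mathbb N$). For $r,s\ge 0$, $k\ge1$: $M^1_{r,s}(a^k,b^k):=\dfrac{I^{r+k}J^{s+k}}{a^kI^rJ^{s+k}+b^kI^{r+k}J^s}$, and $\widetilde{\mathcal F}_{(a,b)}(I^r,J^s):=\bigcup_{k\ge1}\big((I^{r+k}J^s:a^k)\cap(I^rJ^{s+k}:b^k)\big)$. Hilbert coefficients: for an $\mathfrak m$-primary ideal $K$, $\ell(R/K^n)=e_0(K)\binom{n+1}{2}-e_1(K)n+e_2(K)$ for $n\gg0$. Bigraded Hilbert coefficients $e_{(i,j)}$ of $\{I^rJ^s\}$: $\ell(R/I^rJ^s)=\sum_{i+j\le 2}(-1)^{i+j}e_{(i,j)}\binom{r+i-1}{i}\binom{s+j-1}{j}$ for all $r,s\gg0$. For each fixed $r\ge0$ there are integers $g_1(r),g_2(r)$ with $\ell(R/I^rJ^s)=e_0(J)\binom{s+1}{2}-g_1(r)s+g_2(r)$ for all $s\gg0$; for each fixed $s\ge0$ there are integers $h_1(s),h_2(s)$ with $\ell(R/I^rJ^s)=e_0(I)\binom{r+1}{2}-h_1(s)r+h_2(s)$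 for all $r\gg0$. *)

(* Defs.v *)
From HB Require Import structures.
From mathcomp Require Import all_boot all_order all_algebra.
From mathcomp Require Import all_classical.
Set Implicit Arguments.
Unset Strict Implicit.
Unset Printing Implicit Defensive.
Import Order.TTheory GRing.Theory Num.Theory.
Local Open Scope classical_set_scope.
Local Open Scope ring_scope.

(* The ideals of mathcomp.algebra.ring_quotient are proper by definition;     *)
(* here the whole ring has to be an ideal as well (it is I ^^ 0 below).       *)
Definition ideal (R : comNzRingType) (A : set R) : Prop :=
  [/\ A 0, forall x y, A x -> A y -> A (x + y) & forall c x, A x -> A (c * x)].

Definition prime_ideal (R : comNzRingType) (P : set R) : Prop :=
  [/\ ideal P, ~ P 1 & forall x y, P (x * y) -> P x \/ P y].

Definition maximal_ideal (R : comNzRingType) (m : set R) : Prop :=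
  [/\ ideal m, ~ m 1 & forall A, ideal A -> m `<=` A -> A = m \/ A = setT].

Definition ideal_gen (R : comNzRingType) (s : seq R) : set R :=
  [set x | exists c : 'I_(size s) -> R, x = \sum_i c i * s`_i].

Definition noetherian (R : comNzRingType) : Prop :=
  forall A : set R, ideal A -> exists s : seq R, A = ideal_gen s.

Definition strict_chain (R : comNzRingType) (P : set (set R)) (n : nat) : Prop :=
  exists C : nat -> set R,
    (forall i, (i <= n)%N -> P (C i)) /\ (forall i, (i < n)%N -> C i `<` C i.+1).

(* On a nonempty set of naturals, supremum 0 is the maximum if there is one   *)
(* and the junk value 0 if the set is unbounded; so krull_dim R = 2 does mean *)
(* that R has dimension two.                                                  *)
Definition krull_dim (R : comNzRingType) : nat :=
  supremum 0%N [set n | strict_chain [set P : set R | prime_ideal P] n].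

Definition regular_sequence (R : comNzRingType) (s : seq R) : Prop :=
  ~ ideal_gen s 1 /\
  forall i, (i < size s)%N ->
    forall y, ideal_gen (take i s) (s`_i * y) -> ideal_gen (take i s) y.

Definition depth (R : comNzRingType) (m : set R) : nat :=
  supremum 0%N [set n | exists s : seq R,
    [/\ size s = n, forall x, x \in s -> m x & regular_sequence s]].

Definition local_ring (R : comNzRingType) (m : set R) : Prop :=
  [/\ noetherian R, maximal_ideal m & forall n, maximal_ideal n -> n = m].

Definition cohen_macaulay_local (R : comNzRingType) (m : set R) : Prop :=
  local_ring m /\ depth m = krull_dim R.

Definition radical (R : comNzRingType) (A : set R) : set R :=
  [set x | exists n, A (x ^+ n)].

Definition primary_to (R : comNzRingType) (m I : set R) : Prop :=
  [/\ ideal I, ~ I 1,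
      forall x y, I (x * y) -> I x \/ exists n, I (y ^+ n)
    & radical I = m].

(* The R-module B / A, for ideals A `<=` B; its submodules are the C / A with *)
(* C an ideal and A `<=` C `<=` B.                                            *)
Record subquotient (R : comNzRingType) :=
  Subquotient { num : set R; den : set R }.

Notation "B /// A" := (Subquotient B A) (at level 45, no associativity).

Definition cosets (R : comNzRingType) (Q : subquotient R) : set (set R) :=
  [set [set x + y | y in den Q] | x in num Q].

(* den Q is the zero element of the quotient module. *)
Definition zero_module (R : comNzRingType) (Q : subquotient R) : Prop :=
  cosets Q = [set den Q].

(* Junk value 0 for modules of infinite length. *)
Definition length (R : comNzRingType) (Q : subquotient R) : nat :=
  supremum 0%N [set n | strict_chain
    [set C | [/\ ideal C, den Q `<=` C & C `<=` num Q]] n].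

Definition ideal_mul (R : comNzRingType) (A B : set R) : set R :=
  [set x | exists (n : nat) (u v : 'I_n -> R),
     (forall i, A (u i) /\ B (v i)) /\ x = \sum_i u i * v i].

Notation "A ** B" := (ideal_mul A B) (at level 40, left associativity).

Fixpoint ideal_exp (R : comNzRingType) (A : set R) (n : nat) : set R :=
  if n is n'.+1 then A ** ideal_exp A n' else setT.

Notation "A ^^ n" := (ideal_exp A n) (at level 30, right associativity).

Definition principal (R : comNzRingType) (a : R) : set R := [set a * x | x in setT].

Definition colon (R : comNzRingType) (A : set R) (x : R) : set R :=
  [set y | A (y * x)].

Definition joint_reduction_at (R : comNzRingType) (I J : set R) (a b : R)
    (r s : nat) : Prop :=
  I ^^ r.+1 ** J ^^ s.+1 =
  [set a * x + b * y | x in I ^^ r ** J ^^ s.+1 & y in I ^^ r.+1 ** J ^^ s].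

Definition joint_reduction (R : comNzRingType) (I J : set R) (a b : R) : Prop :=
  [/\ I a, J b & exists N, forall r s, (N <= r)%N -> (N <= s)%N ->
    joint_reduction_at I J a b r s].

Definition joint_reduction_lattice (R : comNzRingType) (I J : set R) :
    set (nat * nat) :=
  [set rs | exists a b,
     joint_reduction I J a b /\ joint_reduction_at I J a b rs.1 rs.2].

(* M^1_{r,s}(a^k, b^k): the powers are taken inside. *)
Definition M1 (R : comNzRingType) (I J : set R) (a b : R) (r s k : nat) :
    subquotient R :=
  (I ^^ (r + k) ** J ^^ (s + k)) ///
  [set a ^+ k * x + b ^+ k * y
     | x in I ^^ r ** J ^^ (s + k) & y in I ^^ (r + k) ** J ^^ s].

Definition Ftilde (R : comNzRingType) (I J : set R) (a b : R) (r s : nat) : set R :=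
  \bigcup_(k in [set k | (1 <= k)%N])
    (colon (I ^^ (r + k) ** J ^^ s) (a ^+ k) `&`
     colon (I ^^ r ** J ^^ (s + k)) (b ^+ k)).

Definition colength (R : comNzRingType) (A : set R) : int :=
  (length (setT /// A))%:Z.

(* The coefficients are specified by the polynomials that they determine:     *)
(* in each of the following predicates the integers are unique.               *)
Definition hilbert_coef (R : comNzRingType) (K : set R) (e : nat -> int) : Prop :=
  exists N, forall n, (N <= n)%N ->
    colength (K ^^ n) = e 0%N * 'C(n + 1, 2)%:Z - e 1%N * n%:Z + e 2%N.

Definition bigraded_hilbert_coef (R : comNzRingType) (I J : set R)
    (e : nat -> nat -> int) : Prop :=
  exists N, forall r s, (N <= r)%N -> (N <= s)%N ->
    colength (I ^^ r ** J ^^ s) =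
    \sum_(i < 3) \sum_(j < 3 | (i + j <= 2)%N)
      (-1) ^+ (i + j) * e i j * 'C(r + i - 1, i)%:Z * 'C(s + j - 1, j)%:Z.

Definition fixed_left_coef (R : comNzRingType) (I J : set R) (e0J : int)
    (g1 g2 : nat -> int) : Prop :=
  forall r, exists N, forall s, (N <= s)%N ->
    colength (I ^^ r ** J ^^ s) = e0J * 'C(s + 1, 2)%:Z - g1 r * s%:Z + g2 r.

Definition fixed_right_coef (R : comNzRingType) (I J : set R) (e0I : int)
    (h1 h2 : nat -> int) : Prop :=
  forall s, exists N, forall r, (N <= r)%N ->
    colength (I ^^ r ** J ^^ s) = e0I * 'C(r + 1, 2)%:Z - h1 s * r%:Z + h2 s.

(* Main.v *)
(* Write [P(r, s) = I^r J^s] and [F_{k,l} = (P(r + k, s) : a^k) cap (P(r, s + l) : b^l)].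
   A joint reduction [(a, b)] is a regular sequence in either order, because [R] has
   depth two and [(a, b)] is cofinite. Counting lengths along
   [a^k P(r, s + l) + b^l P(r + k, s) <= a^k R + b^l P(r + k, s) <= (a^k, b^l) <= R] gives
     l(R/(a^k P(r, s + l) + b^l P(r + k, s))) + l(R/F_{k,l})
       = k l * l(R/(a, b)) + l(R/P(r, s + l)) + l(R/P(r + k, s)),
   and the first ideal is contained in [P(r + k, s + l)], with equality for all [k, l] as
   soon as [(a, b)] satisfies the joint reduction equation at [(r, s)]. For large [r, s],
   where [F_{k,l}] is eventually constant, comparison of polynomials in the two
   independent variables [k, l] yields [l(R/(a, b)) = e_(1,1)], [e_0(I) = e_(2,0)] and
   [e_0(J) = e_(0,2)].
   At [(r0, s0)] the hypotheses on [(a)] and [(b)] force [F_{k,l} = P(r0, s0)]. If some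
   other pair [(a', b')] satisfies the equation at [(r0, s0)], its [F'_{k,l}] contains
   [P(r0, s0)], and comparing the two length formulas shows that the formula for
   [P(r0 + k, s0 + l)] is exact for all [k, l]; its coefficients in [k], [l] and its
   constant term are (b). Conversely (b) makes [M^1(a^k, b^k)] vanish for one large [k],
   and cancelling [a^(k-1) b^(k-1)] brings this down to [k = 1]. *)
Require Import Defs.
From HB Require Import structures.
From mathcomp Require Import all_boot all_order all_algebra.
From mathcomp Require Import all_classical.
From mathcomp Require Import zify ring.
Set Implicit Arguments.
Unset Strict Implicit.
Unset Printing Implicit Defensive.
Import Order.TTheory GRing.Theory Num.Theory.
Local Open Scope classical_set_scope.
Local Open Scope ring_scope.

(** * Elementary ideal arithmetic and the sums [aA + bB] *)

Lemma idealN (R : comNzRingType) (A : set R) x : ideal A -> A x -> A (- x).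
Proof. by case=> _ _ AM Ax; rewrite -mulN1r; exact: AM. Qed.

Lemma idealB (R : comNzRingType) (A : set R) x y :
  ideal A -> A x -> A y -> A (x - y).
Proof. by move=> iA Ax Ay; case: (iA) => _ AD _; apply: AD => //; exact: idealN. Qed.

Lemma idealMr (R : comNzRingType) (A : set R) x c : ideal A -> A x -> A (x * c).
Proof. by case=> _ _ AM Ax; rewrite mulrC; exact: AM. Qed.

Lemma idealT (R : comNzRingType) : ideal [set: R].
Proof. by []. Qed.

Lemma ideal1 (R : comNzRingType) (A : set R) : ideal A -> A 1 -> A = setT.
Proof.
move=> iA A1; apply/seteqP; split=> // x _.
by rewrite -[x]mulr1; case: iA => _ _; apply.
Qed.

Lemma ideal_sum (R : comNzRingType) (A : set R) n (f : 'I_n -> R) :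
  ideal A -> (forall i, A (f i)) -> A (\sum_i f i).
Proof. by case=> A0 AD _ Af; elim/big_ind: _. Qed.

Lemma idealI (R : comNzRingType) (A B : set R) :
  ideal A -> ideal B -> ideal (A `&` B).
Proof.
case=> A0 AD AM [B0 BD BM]; split=> //.
- by move=> x y [? ?] [? ?]; split; [exact: AD|exact: BD].
- by move=> c x [? ?]; split; [exact: AM|exact: BM].
Qed.

Lemma ideal_colon (R : comNzRingType) (A : set R) x : ideal A -> ideal (colon A x).
Proof.
case=> A0 AD AM; split; rewrite /colon /=.
- by rewrite mul0r.
- by move=> y z Ay Az; rewrite mulrDl; exact: AD.
- by move=> c y Ay; rewrite -mulrA; exact: AM.
Qed.

Lemma sub_colon (R : comNzRingType) (A : set R) x : ideal A -> A `<=` colon A x.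
Proof. by move=> iA y Ay; exact: idealMr. Qed.

Definition ideal_add (R : comNzRingType) (A B : set R) : set R :=
  [set x + y | x in A & y in B].

Lemma ideal_ideal_add (R : comNzRingType) (A B : set R) :
  ideal A -> ideal B -> ideal (ideal_add A B).
Proof.
case=> A0 AD AM [B0 BD BM]; split.
- by exists 0 => //; exists 0 => //; rewrite addr0.
- move=> _ _ [x Ax [y By <-]] [x' Ax' [y' By' <-]].
  by exists (x + x'); [exact: AD|exists (y + y'); [exact: BD|ring]].
- move=> c _ [x Ax [y By <-]].
  by exists (c * x); [exact: AM|exists (c * y); [exact: BM|ring]].
Qed.

(** The shape of the right-hand side in [joint_reduction_at] and of the denominator in [M1]. With
    [a = 1] it also serves as [A + bB]. *)
Definition span (R : comNzRingType) (a : R) (A : set R) (b : R) (B : set R) : set R :=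
  [set a * x + b * y | x in A & y in B].

Lemma ideal_span (R : comNzRingType) (a b : R) (A B : set R) :
  ideal A -> ideal B -> ideal (span a A b B).
Proof.
case=> A0 AD AM [B0 BD BM]; split.
- by exists 0 => //; exists 0 => //; rewrite !mulr0 addr0.
- move=> _ _ [x Ax [y By <-]] [x' Ax' [y' By' <-]].
  by exists (x + x'); [exact: AD|exists (y + y'); [exact: BD|ring]].
- move=> c _ [x Ax [y By <-]].
  by exists (c * x); [exact: AM|exists (c * y); [exact: BM|ring]].
Qed.

Lemma span_subset (R : comNzRingType) (a b : R) (A B C : set R) : ideal C ->
  (forall x, A x -> C (a * x)) -> (forall y, B y -> C (b * y)) ->
  span a A b B `<=` C.
Proof. by case=> _ CD _ aA bB _ [x Ax [y By <-]]; apply: CD; auto. Qed.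

Lemma spanl (R : comNzRingType) (a b : R) (A B : set R) x :
  ideal B -> A x -> span a A b B (a * x).
Proof. by case=> B0 _ _ Ax; exists x => //; exists 0 => //; rewrite mulr0 addr0. Qed.

Lemma spanr (R : comNzRingType) (a b : R) (A B : set R) y :
  ideal A -> B y -> span a A b B (b * y).
Proof. by case=> A0 _ _ By; exists 0 => //; exists y => //; rewrite mulr0 add0r. Qed.

(** * Noetherian rings *)

Lemma ideal_gen_subset (R : comNzRingType) (s : seq R) (A : set R) :
  ideal A -> (forall x, x \in s -> A x) -> ideal_gen s `<=` A.
Proof.
move=> iA sA _ [c ->]; apply: ideal_sum => // i.
by case: iA => _ _; apply; apply: sA; rewrite mem_nth.
Qed.

Lemma ideal_gen_mem (R : comNzRingType) (s : seq R) x : x \in s -> ideal_gen s x.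
Proof.
move=> xs; have lt_i : (index x s < size s)%N by rewrite index_mem.
exists (fun i => if i == Ordinal lt_i then 1 else 0).
rewrite (bigD1 (Ordinal lt_i)) //= eqxx mul1r nth_index // big1 ?addr0 // => i ne.
by rewrite (negPf ne) mul0r.
Qed.

Lemma chain_homo (T : Type) (C : nat -> set T) :
  (forall i, C i `<=` C i.+1) -> forall i j, (i <= j)%N -> C i `<=` C j.
Proof.
move=> CS i j /subnKC <-; elim: (j - i)%N => [|k IH]; first by rewrite addn0.
by rewrite addnS; exact: subset_trans IH (CS _).
Qed.

Lemma noetherian_stationary (R : comNzRingType) (C : nat -> set R) :
  noetherian R -> (forall i, ideal (C i)) -> (forall i, C i `<=` C i.+1) ->
  exists N, forall i, (N <= i)%N -> C i = C N.
Proof.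
move=> nR iC CS; have Chom := chain_homo CS.
have iU : ideal (\bigcup_i C i).
  split; first by exists 0%N => //; case: (iC 0%N).
  - move=> x y [i _ Cx] [j _ Cy]; exists (maxn i j) => //.
    by case: (iC (maxn i j)) => _ CD _; apply: CD;
      [exact: Chom (leq_maxl _ _) _ Cx|exact: Chom (leq_maxr _ _) _ Cy].
  - by move=> c x [i _ Cx]; exists i => //; case: (iC i) => _ _; apply.
have [s Us] := nR _ iU.
have [N CN] : exists N, forall x, x \in s -> C N x.
  have: forall x, x \in s -> (\bigcup_i C i) x by rewrite Us => x; exact: ideal_gen_mem.
  elim: (s) => [|x t IH] sU; first by exists 0%N.
  have [|N CN] := IH; first by move=> y yt; apply: sU; rewrite inE yt orbT.
  have [i _ Cx] := sU x (mem_head _ _).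
  exists (maxn i N) => y; rewrite inE => /predU1P[->|/CN].
    by apply: Chom Cx; exact: leq_maxl.
  by apply: Chom; exact: leq_maxr.
exists N => i leNi; apply/seteqP; split; last exact: Chom.
move=> x Cx; apply: (ideal_gen_subset (iC N) CN).
by rewrite -Us; exists i.
Qed.

Lemma noetherian_maximal (R : comNzRingType) (P : set (set R)) :
  noetherian R -> (forall A, P A -> ideal A) -> P !=set0 ->
  exists2 A, P A & forall B, P B -> A `<=` B -> B = A.
Proof.
move=> nR iP [A0 PA0]; apply: contrapT => noMax.
have next (A : {A | P A}) : exists B : {A | P A}, sval A `<` sval B.
  apply: contrapT => noB; apply: noMax; exists (sval A); first exact: svalP.
  move=> B PB AB; apply/seteqP; split=> //; apply: contrapT => nBA.
  by apply: noB; exists (exist _ B PB).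
have [f fP] := choice next.
pose C i := iter i f (exist _ A0 PA0).
have [||N CN] := @noetherian_stationary _ (fun i => sval (C i)) nR.
- by move=> i; apply: iP; exact: svalP.
- by move=> i; case: (fP (C i)).
- by have := fP (C N); rewrite -[f _]/(C N.+1) (CN N.+1 (leqnSn N)) => -[_]; apply.
Qed.

(** * Lengths *)

Definition between (R : comNzRingType) (A B : set R) : set (set R) :=
  [set C | [/\ ideal C, A `<=` C & C `<=` B]].

Definition chains (R : comNzRingType) (A B : set R) : set nat :=
  [set n | strict_chain (between A B) n].

(** A relation rather than a value: the maximum is attained, so the junk value 0 of [length] cannot
    interfere. *)
Definition has_length (R : comNzRingType) (A B : set R) (n : nat) : Prop :=
  chains A B n /\ forall k, chains A B k -> (k <= n)%N.

Definition colen (R : comNzRingType) (A : set R) : nat := length (setT /// A).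

Lemma chains_sub (R : comNzRingType) (A B A' B' : set R) n :
  A' `<=` A -> B `<=` B' -> chains A B n -> chains A' B' n.
Proof.
move=> A'A BB' [C [CP Clt]]; exists C; split=> // i /CP[iC AC CB]; split=> //.
  exact: subset_trans A'A AC.
exact: subset_trans CB BB'.
Qed.

Lemma chains0 (R : comNzRingType) (A B : set R) : ideal B -> A `<=` B -> chains A B 0.
Proof. by move=> iB AB; exists (fun=> B); split=> // i _; split. Qed.

Lemma chainsS (R : comNzRingType) (A B B' : set R) n :
  A `<=` B -> ideal B' -> B `<` B' -> chains A B n -> chains A B' n.+1.
Proof.
move=> AB iB' [BB' nB'B] [C [CP Clt]].
exists (fun i => if (i <= n)%N then C i else B'); split=> i lei.
  case: ifP => [/CP[iC AC CB]|_]; split=> //; first exact: subset_trans CB BB'.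
  exact: subset_trans AB BB'.
rewrite -ltnS lei; case: ltnP => [/Clt//|leni].
have [iC AC CB] : between A B (C i) by apply: CP.
by split; [exact: subset_trans CB BB'|move=> B'C; apply: nB'B; exact: subset_trans CB].
Qed.

Lemma chains_cat (R : comNzRingType) (A B C : set R) p q :
  A `<=` B -> B `<=` C -> chains A B p -> chains B C q -> chains A C (p + q).
Proof.
move=> AB BC [D [DP Dlt]] [E [EP Elt]].
(* [D p] is dropped because it may coincide with [E 0]; the joint stays strict since [D p] lies in
   [B] and [B] in [E 0]. *)
exists (fun i => if (i < p)%N then D i else E (i - p)%N); split=> i lei.
  case: ltnP => [/ltnW/DP[iD AD DB]|lepi].
    by split=> //; exact: subset_trans DB BC.
  have [|iE BE EC] := EP (i - p)%N; first by lia.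
  by split=> //; exact: subset_trans AB BE.
case: (ltnP i p) => [lt_ip|lepi]; last first.
  by rewrite ltnNge leqW //= subSn //; apply: Elt; lia.
have [DD nDD] := Dlt i lt_ip.
case: ltnP => [//|lepi1]; have -> : (i.+1 - p = 0)%N by lia.
have [_ _ DB] := DP i.+1 lt_ip; have [_ BE _] := EP 0%N isT.
have DE := subset_trans DB BE.
by split; [exact: subset_trans DD DE|move=> ED; apply: nDD; exact: subset_trans ED].
Qed.

(** Modular law: ideals [C <= D] with the same trace on [B] and the same sum with [B] are equal. *)
Lemma modular_strict (R : comNzRingType) (B C D : set R) :
  ideal B -> ideal C -> ideal D -> C `<` D ->
  C `&` B `<` D `&` B \/ ideal_add B C `<` ideal_add B D.
Proof.
move=> iB iC iD [CD nDC].
have [DBC|] := pselect (D `&` B `<=` C `&` B); last first.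
  by move=> nDBC; left; split=> //; exact: setSI.
right; split.
  by move=> _ [x Bx [y Cy <-]]; exists x => //; exists y => //; exact: CD.
move=> BDC; apply: nDC => x Dx.
have [|y By [z Cz xE]] := BDC x.
  by exists 0; [case: iB|exists x; rewrite // add0r].
rewrite -xE; case: (iC) => _ CDD _; apply: CDD => //.
have [] // := DBC y; split=> //.
have -> : y = x - z by rewrite -xE addrK.
by apply: idealB => //; exact: CD.
Qed.

(** By [modular_strict], each strict step of [E] survives in the traces on [B] or in the sums with
    [B], so it lengthens one of the two chains. This is the upper bound in the additivity of
    length. *)
Lemma chains_split (R : comNzRingType) (A B : set R) n (E : nat -> set R) :
  ideal B -> A `<=` B ->
  (forall i, (i <= n)%N -> ideal (E i) /\ A `<=` E i) ->
  (forall i, (i < n)%N -> E i `<` E i.+1) ->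
  exists p q, [/\ chains A (E n `&` B) p, chains B (ideal_add B (E n)) q
                & (n <= p + q)%N].
Proof.
move=> iB AB; elim: n => [|n IH] EP Elt.
  have [iE AE] := EP 0%N isT.
  exists 0%N, 0%N; split=> //; apply: chains0.
  - exact: idealI.
  - by move=> x Ax; split; [exact: AE|exact: AB].
  - exact: ideal_ideal_add.
  - by move=> x Bx; exists x => //; exists 0; rewrite ?addr0 //; case: iE.
have [||p [q [chp chq lepq]]] := IH.
- by move=> i lei; apply: EP; exact: leqW.
- by move=> i lti; apply: Elt; exact: ltnW.
have [iE AE] := EP n (leqnSn n); have [iE' AE'] := EP n.+1 (leqnn _).
have EE := Elt n (leqnn _); have [sEE _] := EE.
have AEB : A `<=` E n `&` B by move=> x Ax; split; [exact: AE|exact: AB].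
have BBE : B `<=` ideal_add B (E n).
  by move=> x Bx; exists x => //; exists 0; rewrite ?addr0 //; case: iE.
have sI : E n `&` B `<=` E n.+1 `&` B by exact: setSI.
have sD : ideal_add B (E n) `<=` ideal_add B (E n.+1).
  by move=> _ [x Bx [y Ey <-]]; exists x => //; exists y => //; exact: sEE.
have [ltI|ltD] := modular_strict iB iE iE' EE.
- exists p.+1, q; split; last by lia.
    by apply: chainsS ltI chp => //; exact: idealI.
  exact: chains_sub sD chq.
- exists p, q.+1; split; last by lia.
    exact: chains_sub sI chp.
  by apply: chainsS ltD chq => //; exact: ideal_ideal_add.
Qed.

Lemma has_length_uniq (R : comNzRingType) (A B : set R) n k :
  has_length A B n -> has_length A B k -> n = k.
Proof. by move=> [cn le_n] [ck le_k]; apply/eqP; rewrite eqn_leq le_n // le_k. Qed.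

Lemma has_length_cat (R : comNzRingType) (A B C : set R) p q :
  ideal B -> ideal C -> A `<=` B -> B `<=` C ->
  has_length A B p -> has_length B C q -> has_length A C (p + q).
Proof.
move=> iB iC AB BC [chp lep] [chq leq]; split; first exact: (chains_cat AB BC).
move=> n [E [EP Elt]].
have [|p' [q' [chp' chq' len]]] := chains_split iB AB _ Elt.
  by move=> i /EP[].
apply: (leq_trans len); apply: leq_add.
  by apply: lep; apply: chains_sub chp'.
apply: leq; apply: chains_sub chq' => //.
have [_ _ EC] := EP n (leqnn n) => _ [x Bx [y Ey <-]].
by case: iC => _ CD _; apply: CD; [exact: BC|exact: EC].
Qed.

Lemma has_length_exists (R : comNzRingType) (A B : set R) N :
  ideal B -> A `<=` B -> (forall k, chains A B k -> (k <= N)%N) ->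
  exists n, has_length A B n.
Proof.
move=> iB AB leN.
have ex : exists n, `[< chains A B n >] by exists 0%N; apply/asboolP; exact: chains0.
have bd n : `[< chains A B n >] -> (n <= N)%N by move/asboolP/leN.
case: (ex_maxnP ex bd) => n /asboolP chn max_n; exists n; split=> // k chk.
by apply: max_n; apply/asboolP.
Qed.

Lemma has_length_length (R : comNzRingType) (A B : set R) n :
  has_length A B n -> length (B /// A) = n.
Proof.
move=> [chn le_n]; rewrite /length /= /supremum.
case: ifPn => [/eqP E|_].
  by have : (set0 : set nat) n by rewrite -E.
have Sn : supremums (chains A B) n.
  split; first by move=> k chk /=; rewrite leEnat; exact: le_n.
  by move=> k; apply.
case: xgetP => [k _ Sk|/(_ n)//].
by apply: (is_subset1_supremums Sk Sn).
Qed.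

(** The monotone left inverse [g] makes [f] reflect inclusions, so strict steps stay strict. *)
Lemma chains_mono (R : comNzRingType) (A B A' B' : set R) (f g : set R -> set R) n :
  (forall C, between A B C -> between A' B' (f C)) ->
  (forall C D, C `<=` D -> f C `<=` f D) -> (forall C D, C `<=` D -> g C `<=` g D) ->
  (forall C, between A B C -> g (f C) = C) ->
  chains A B n -> chains A' B' n.
Proof.
move=> fP f_homo g_homo gf [C [CP Clt]]; exists (fun i => f (C i)); split.
  by move=> i /CP/fP.
move=> i lti; have [CC nCC] := Clt i lti; split; first exact: f_homo.
by move/g_homo; rewrite !gf //; apply: CP; lia.
Qed.

Lemma has_length_mono (R : comNzRingType) (A B A' B' : set R) (f g : set R -> set R) n :
  (forall C, between A B C -> between A' B' (f C)) ->
  (forall C, between A' B' C -> between A B (g C)) ->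
  (forall C D, C `<=` D -> f C `<=` f D) -> (forall C D, C `<=` D -> g C `<=` g D) ->
  (forall C, between A B C -> g (f C) = C) ->
  (forall C, between A' B' C -> f (g C) = C) ->
  has_length A B n -> has_length A' B' n.
Proof.
move=> fP gP fh gh gf fg [chn le_n]; split; first exact: (chains_mono fP fh gh gf).
by move=> k /(chains_mono gP gh fh fg); exact: le_n.
Qed.

(* Multiplication by [x] induces an isomorphism [B / (B cap (N : x)) ~ (N + xB) / N], *)
(* where [N + xB] is written [span 1 N x B]. *)
Lemma has_length_mul (R : comNzRingType) (N B : set R) (x : R) n :
  ideal N -> ideal B ->
  has_length (B `&` colon N x) B n <-> has_length N (span 1 N x B) n.
Proof.
move=> iN iB.
pose f (C : set R) := span 1 N x C; pose g (D : set R) := B `&` colon D x.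
have fP C : between (B `&` colon N x) B C -> between N (span 1 N x B) (f C).
  move=> [iC NC CB]; split; first exact: ideal_span.
    by move=> y Ny; rewrite -[y]mul1r; exact: spanl.
  by move=> _ [y Ny [z Cz <-]]; exists y => //; exists z => //; exact: CB.
have gP D : between N (span 1 N x B) D -> between (B `&` colon N x) B (g D).
  move=> [iD ND _]; split; [exact/idealI/ideal_colon| |by move=> y []].
  by move=> y [By Ny]; split=> //; exact: ND.
have fh (C D : set R) : C `<=` D -> f C `<=` f D.
  by move=> CD _ [y Ny [z Cz <-]]; exists y => //; exists z => //; exact: CD.
have gh (C D : set R) : C `<=` D -> g C `<=` g D.
  by move=> CD y [By Cy]; split=> //; exact: CD.
have gf C : between (B `&` colon N x) B C -> g (f C) = C.
  move=> [iC NC CB]; apply/seteqP; split=> [y [By [z Nz [w Cw E]]]|y Cy].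
    rewrite -[y](subrK w); case: (iC) => _ CD _; apply: CD => //; apply: NC.
    split; first by apply: idealB => //; exact: CB.
    by rewrite /colon/= mulrBl -E mul1r mulrC addrK.
  by split; [exact: CB|rewrite /colon/= mulrC; exact: spanr].
have fg D : between N (span 1 N x B) D -> f (g D) = D.
  move=> [iD ND DB]; apply/seteqP; split=> [|y Dy].
    apply: span_subset => // y; first by rewrite mul1r; exact: ND.
    by rewrite mulrC => -[].
  have [z Nz [w Bw E]] := DB y Dy; exists z => //; exists w => //; split=> //.
  have wxE : w * x = y - z by rewrite -E; ring.
  rewrite /colon /= wxE; apply: idealB => //; exact: ND.
by split; [exact: has_length_mono fP gP fh gh gf fg|exact: has_length_mono gP fP gh fh fg gf].
Qed.

(** * Finite length over a local ring *)

Lemma has_length_simple (R : comNzRingType) (m : set R) :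
  maximal_ideal m -> has_length m setT 1.
Proof.
case=> im m1 max; split.
  apply: (@chainsS _ m m setT 0) => //; last exact: chains0.
  by split=> // sub; apply: m1; exact: sub.
case=> [|[|k]] // [C [CP Clt]].
have [iC0 mC0 _] := CP 0%N isT; have [iC1 mC1 _] := CP 1%N isT.
have [_ n01] := Clt 0%N isT; have [_ n12] := Clt 1%N isT.
case: (max _ iC1 mC1) => C1E; first by case: n01; rewrite C1E.
by case: n12; rewrite C1E.
Qed.

(** Unlike [primary_to], this admits the unit ideal; hence it covers [I ^^ 0] and is stable under
    colon ideals. *)
Definition cofinite (R : comNzRingType) (m A : set R) : Prop :=
  ideal A /\ forall x, m x -> exists n, A (x ^+ n).

Lemma cofinite_sub (R : comNzRingType) (m A B : set R) :
  cofinite m A -> ideal B -> A `<=` B -> cofinite m B.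
Proof. by move=> [_ rA] iB AB; split=> // x /rA[n An]; exists n; exact: AB. Qed.

Lemma cofiniteT (R : comNzRingType) (m : set R) : cofinite m setT.
Proof. by split=> // x _; exists 0%N. Qed.

Lemma cofiniteI (R : comNzRingType) (m A B : set R) :
  cofinite m A -> cofinite m B -> cofinite m (A `&` B).
Proof.
move=> [iA rA] [iB rB]; split=> [|x mx]; first exact: idealI.
have [n An] := rA x mx; have [k Bk] := rB x mx; exists (n + k)%N.
by rewrite exprD; split; [exact: idealMr|case: iB => _ _; exact].
Qed.

Lemma cofinite_colon (R : comNzRingType) (m A : set R) x :
  cofinite m A -> cofinite m (colon A x).
Proof.
by move=> cA; case: (cA) => iA _; apply: cofinite_sub cA (ideal_colon x iA) (sub_colon x iA).
Qed.

Lemma cofinite_span (R : comNzRingType) (m A B : set R) a b :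
  cofinite m A -> cofinite m B -> cofinite m (span a setT b setT) ->
  cofinite m (span a A b B).
Proof.
move=> [iA rA] [iB rB] [_ rab]; split=> [|x mx]; first exact: ideal_span.
have [k Ak] := rA x mx; have [l Bl] := rB x mx; have [n [u _ [v _ E]]] := rab x mx.
exists (n + (k + l))%N; exists (u * x ^+ (k + l)).
  by rewrite exprD mulrA -mulrA mulrC -mulrA; exact: idealMr.
exists (v * x ^+ (k + l)); last by rewrite [RHS]exprD -E; ring.
by rewrite exprD mulrA; case: iB => _ _; exact.
Qed.

(** Choose [x] outside [A] with [A : x] maximal. If some [z] in [m] had [z * x] outside [A],
    maximality would give [A : z^n x = A : x] for all [n], and no [z^n x] would ever enter [A],
    although a power of [z] lies in [A]. *)
Lemma cofinite_socle (R : comNzRingType) (m A : set R) :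
  local_ring m -> cofinite m A -> ~ A 1 -> exists2 x, ~ A x & colon A x = m.
Proof.
move=> [nR [im m1 max] uniq] [iA rA] A1.
pose P := [set C : set R | exists2 x, ~ A x & C = colon A x].
have [||_ [x Ax ->] xmax] := @noetherian_maximal _ P nR.
- by move=> _ [x _ ->]; exact: ideal_colon.
- by exists (colon A 1), 1.
exists x => //.
have mx : m `<=` colon A x.
  move=> z mz; apply: contrapT => zx.
  have Anx n : ~ A (z ^+ n * x).
    elim: n => [|n IH]; first by rewrite mul1r.
    have E : colon A (z ^+ n * x) = colon A x.
      apply: xmax; first by exists (z ^+ n * x).
      by move=> y Ay; rewrite /colon/= mulrCA; case: iA => _ _; exact.
    move=> AS; apply: zx; rewrite -E /colon /=.
    by rewrite mulrA -exprS.
  by have [n An] := rA z mz; apply: (Anx n); exact: idealMr.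
have [//|T] := max _ (ideal_colon x iA) mx.
have : colon A x 1 by rewrite T.
by rewrite /colon/= mul1r => /Ax.
Qed.

(** Noetherian induction: let [B] be maximal among the cofinite ideals without finite colength. A
    socle element [x] makes [(B + xR) / B] simple, so [B + xR] would be a larger counterexample. *)
Lemma cofinite_has_length (R : comNzRingType) (m A : set R) :
  local_ring m -> cofinite m A -> has_length A setT (colen A).
Proof.
move=> lR cA; suff [n hn] : exists n, has_length A setT n.
  by rewrite /colen (has_length_length hn).
apply: contrapT => noA.
pose P := [set B : set R | cofinite m B /\ ~ exists n, has_length B setT n].
have [nR maxm _] := lR.
have [|B [cB nB] Bmax] := @noetherian_maximal _ P nR _ (ex_intro _ A (conj cA noA)).
  by move=> B [[]].
have [iB _] := cB; case: (pselect (B 1)) => [B1|B1].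
  apply: nB; rewrite (ideal1 iB B1).
  apply: (@has_length_exists _ _ _ 0) => // k [C [CP Clt]].
  case: k CP Clt => // k CP Clt; have [_ nC] := Clt 0%N isT.
  by have [_ TC _] := CP 0%N isT; case: nC => x _; exact: TC.
have [x Bx Bxm] := cofinite_socle lR cB B1.
have iBx : ideal (span 1 B x setT) by exact: ideal_span.
have BBx : B `<=` span 1 B x setT by move=> y By; rewrite -[y]mul1r; exact: spanl.
have h1 : has_length B (span 1 B x setT) 1.
  by apply/has_length_mul => //; rewrite setTI Bxm; exact: has_length_simple.
have [[q hq]|nBx] := pselect (exists n, has_length (span 1 B x setT) setT n).
  by apply: nB; exists (1 + q)%N; exact: has_length_cat h1 hq.
have E := Bmax _ (conj (cofinite_sub cB iBx BBx) nBx) BBx.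
by apply: Bx; rewrite -E; have := @spanr _ 1 x B setT 1 iB I; rewrite mulr1.
Qed.

Lemma colen_sub (R : comNzRingType) (m A B : set R) :
  local_ring m -> cofinite m A -> ideal B -> A `<=` B ->
  has_length A B (length (B /// A)) /\ (colen A = length (B /// A) + colen B)%N.
Proof.
move=> lR cA iB AB; have hA := cofinite_has_length lR cA.
have hB := cofinite_has_length lR (cofinite_sub cA iB AB).
have [p hp] : exists p, has_length A B p.
  apply: has_length_exists => // k chk; case: hA => _; apply.
  exact: chains_sub chk.
rewrite (has_length_length hp); split=> //.
apply: has_length_uniq hA _; exact: has_length_cat hp hB.
Qed.

Lemma colen_le (R : comNzRingType) (m A B : set R) :
  local_ring m -> cofinite m A -> ideal B -> A `<=` B -> (colen B <= colen A)%N.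
Proof. by move=> lR cA iB AB; have [_ ->] := colen_sub lR cA iB AB; exact: leq_addl. Qed.

Lemma colen_eq (R : comNzRingType) (m A B : set R) :
  local_ring m -> cofinite m A -> ideal B -> A `<=` B ->
  (colen A <= colen B)%N -> A = B.
Proof.
move=> lR cA iB AB le_AB; have [[_ max] E] := colen_sub lR cA iB AB.
have L0 : length (B /// A) = 0%N by lia.
apply/seteqP; split=> //; apply: contrapT => nBA.
have [iA _] := cA.
by have := max 1%N (chainsS (@subset_refl _ A) iB (conj AB nBA) (chains0 iA (@subset_refl _ A)));
  rewrite L0.
Qed.

(** The isomorphism behind [has_length_mul], written without subtraction. All later colength
    formulas are sums of instances of this one. *)
Lemma colen_mul (R : comNzRingType) (m N B : set R) x :
  local_ring m -> cofinite m N -> cofinite m B ->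
  (colen N + colen B = colen (span 1 N x B) + colen (B `&` colon N x))%N.
Proof.
move=> lR cN cB; have [iN _] := cN; have [iB _] := cB.
have cI := cofiniteI cB (cofinite_colon x cN).
have [h1 ->] := colen_sub lR cI iB (@subIsetl _ _ _).
have [|h2 ->] := colen_sub lR cN (ideal_span 1 x iN iB).
  by move=> y Ny; rewrite -[y]mul1r; exact: spanl.
have := has_length_uniq ((has_length_mul _ _ iN iB).1 h1) h2; lia.
Qed.

Lemma colenT (R : comNzRingType) (m : set R) : local_ring m -> colen [set: R] = 0%N.
Proof.
move=> lR; have [_ E] := colen_sub lR (cofiniteT m) (idealT R) (@subset_refl _ setT).
by move: E; rewrite -/(colen _); lia.
Qed.

(** * Regular pairs *)

(** A regular sequence in either order, in symmetric form. The two elements may generate the unit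
    ideal, which lets exponent 0 through in [regular_pairX]. *)
Definition regular_pair (R : comNzRingType) (a b : R) : Prop :=
  [/\ forall u, a * u = 0 -> u = 0, forall u, b * u = 0 -> u = 0
    & forall u v, a * u = b * v -> exists2 t, u = b * t & v = a * t].

Lemma regular_pair_sym (R : comNzRingType) (a b : R) :
  regular_pair a b -> regular_pair b a.
Proof. by case=> ra rb rab; split=> // u v /esym/rab[t -> ->]; exists t. Qed.

Lemma regular_pair1 (R : comNzRingType) (b : R) :
  (forall u, b * u = 0 -> u = 0) -> regular_pair 1 b.
Proof. by move=> rb; split=> // [u|u v]; rewrite mul1r // => ->; exists v; rewrite ?mul1r. Qed.

Lemma regular_pairM (R : comNzRingType) (a b c : R) :
  regular_pair a c -> regular_pair b c -> regular_pair (a * b) c.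
Proof.
move=> [ra rc rac] [rb _ rbc]; split=> // [u|u v]; rewrite -mulrA.
  by move/ra/rb.
by move/rac => [t /rbc[t' -> ->] ->]; exists t'; rewrite ?mulrA.
Qed.

Lemma regular_pairX (R : comNzRingType) (a b : R) k l :
  regular_pair a b -> regular_pair (a ^+ k) (b ^+ l).
Proof.
move=> rab; have rk : regular_pair (a ^+ k) b.
  elim: k => [|k IH]; last by rewrite exprS; exact: regular_pairM.
  by rewrite expr0; apply: regular_pair1; case: rab.
elim: l => [|l IH].
  by rewrite expr0; apply/regular_pair_sym/regular_pair1; case: rk.
by rewrite exprS; apply/regular_pair_sym/regular_pairM; exact: regular_pair_sym.
Qed.

(** [1 - c] is a unit: otherwise a maximal ideal containing it, found by the Noetherian property,
    would be [m], which contains [c]. *)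
Lemma local_subr1_reg (R : comNzRingType) (m : set R) (c t : R) :
  local_ring m -> m c -> (1 - c) * t = 0 -> t = 0.
Proof.
move=> [nR [[_ mD _] m1 _] uniq] mc ct0.
have [[d _ dE]|n1] := pselect (principal (1 - c) 1).
  by rewrite -[t]mul1r -dE mulrAC ct0 mul0r.
pose P := [set A : set R | [/\ ideal A, ~ A 1 & A (1 - c)]].
have [|| A [iA A1 Ac] Amax] := @noetherian_maximal _ P nR.
- by move=> A [].
- exists (principal (1 - c)); split=> //; last by exists 1; rewrite ?mulr1.
  split; first by exists 0; rewrite ?mulr0.
  + by move=> _ _ [x _ <-] [y _ <-]; exists (x + y); rewrite ?mulrDr.
  + by move=> z _ [x _ <-]; exists (z * x); rewrite // mulrCA.
have AE : A = m.
  apply: uniq; split=> // B iB AB; have [B1|B1] := pselect (B 1).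
    by right; exact: ideal1.
  by left; apply: Amax => //; split=> //; exact: AB.
by case: m1; rewrite -[1](subrK c); apply: mD => //; rewrite -AE.
Qed.

(** A Nakayama argument for the annihilator of [a]: comparing [a * u = 0] with [b * 0] gives
    [u = b * t] with [a * t = 0], so [u = u_0 = b u_1], [u_1 = b u_2], and so on. The ideals [(u_i)]
    increase; where they stop, [u_(N+1) = c u_N = b c u_(N+1)], and [1 - b c] is cancellable. *)
Lemma local_nzd (R : comNzRingType) (m : set R) (a b : R) :
  local_ring m -> m b ->
  (forall u v, a * u = b * v -> exists2 t, u = b * t & v = a * t) ->
  forall u, a * u = 0 -> u = 0.
Proof.
move=> lR mb rab.
have div (u : {u | a * u = 0}) : exists v : {u | a * u = 0}, sval u = b * sval v.
  case: u => u /= u0; have [|t uE tE] := rab u 0; first by rewrite mulr0.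
  by exists (exist _ t (esym tE)).
have [f fE] := choice div => u u0.
pose U i : {u | a * u = 0} := iter i f (exist _ u u0).
have UE i : sval (U i) = b * sval (U i.+1) by exact: fE.
have [nR maxm _] := lR; have [im _ _] := maxm.
have [||N UN] := @noetherian_stationary _ (fun i => principal (sval (U i))) nR.
- move=> i; split; first by exists 0; rewrite ?mulr0.
  + by move=> _ _ [x _ <-] [y _ <-]; exists (x + y); rewrite ?mulrDr.
  + by move=> z _ [x _ <-]; exists (z * x); rewrite // mulrCA.
- by move=> i _ [x _ <-]; exists (b * x); rewrite // (UE i); ring.
have [c _ cE] : principal (sval (U N)) (sval (U N.+1)).
  by rewrite -(UN N.+1) //; exists 1; rewrite ?mulr1.
have UN0 : sval (U N.+1) = 0.
  apply: (local_subr1_reg (c := b * c)) lR (idealMr _ im mb) _.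
  have E : sval (U N.+1) = b * sval (U N.+1) * c by rewrite -{1}cE (UE N).
  have -> : (1 - b * c) * sval (U N.+1) = sval (U N.+1) - b * sval (U N.+1) * c.
    by move: (sval _) => t; ring.
  by rewrite -E subrr.
have U0 : sval (U N) = 0 by rewrite UE UN0 mulr0.
elim: (N) U0 => [//|n IH] Un; apply: IH; by rewrite UE Un mulr0.
Qed.

Lemma regular_powers (R : comNzRingType) (x y : R) k l :
  (forall u, x * u = 0 -> u = 0) ->
  (forall u, principal x (y * u) -> principal x u) ->
  (forall u, x ^+ k * u = 0 -> u = 0) /\
  (forall u, principal (x ^+ k) (y ^+ l * u) -> principal (x ^+ k) u).
Proof.
move=> rx rxy; have rxk u : x ^+ k * u = 0 -> u = 0.
  by elim: k => [|k IH]; rewrite ?mul1r // exprS -mulrA => /rx.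
split=> //; elim: l => [|l IH] u; first by rewrite mul1r.
rewrite exprS -mulrA => E; apply: IH; move: (y ^+ l * u) E => {}u.
elim: k {rxk} u => [|k IH] u; first by exists u; rewrite // mul1r.
case=> w _ E; have [|v _ vE] := rxy u.
  by exists (x ^+ k * w) => //; rewrite mulrA -exprS.
have [|z _ zE] := IH v; last by exists z; rewrite // exprS -mulrA zE.
exists w => //; apply/eqP; rewrite -subr_eq0; apply/eqP/rx.
by rewrite mulrBr mulrA -exprS E -vE; ring.
Qed.

(* A cycle of the Koszul complex of [(a, b)] becomes a boundary after multiplication *)
(* by [x] and by [y]; regularity of [x, y] makes the two preimages compatible, so that *)
(* the cycle itself is a boundary. *)
Lemma regular_pair_of_span (R : comNzRingType) (m : set R) (a b x y : R) :
  local_ring m -> m a -> m b ->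
  (forall u, x * u = 0 -> u = 0) ->
  (forall u, principal x (y * u) -> principal x u) ->
  span a setT b setT x -> span a setT b setT y -> regular_pair a b.
Proof.
move=> lR ma mb rx rxy [p _ [q _ xE]] [p' _ [q' _ yE]].
have ann u : a * u = 0 -> b * u = 0 -> u = 0.
  move=> au bu; apply: rx; rewrite -xE.
  transitivity (p * (a * u) + q * (b * u)); first by ring.
  by rewrite au bu !mulr0 addr0.
have rab u v : a * u = b * v -> exists2 t, u = b * t & v = a * t.
  move=> E; pose w := q * u + p * v; pose w' := q' * u + p' * v.
  have xu : x * u = b * w.
    transitivity (p * (a * u) + b * (q * u)); first by rewrite -xE; ring.
    by rewrite E /w; ring.
  have xv : x * v = a * w.
    transitivity (a * (p * v) + q * (b * v)); first by rewrite -xE; ring.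
    by rewrite -E /w; ring.
  have yu : y * u = b * w'.
    transitivity (p' * (a * u) + b * (q' * u)); first by rewrite -yE; ring.
    by rewrite E /w'; ring.
  have yv : y * v = a * w'.
    transitivity (a * (p' * v) + q' * (b * v)); first by rewrite -yE; ring.
    by rewrite -E /w'; ring.
  (* Both products have the same multiples by [a] and by [b], namely those read off from [x * y * v]
     and [x * y * u]. Then [x] divides [y * w], hence [w], and the quotient [t] is the required
     witness. *)
  have ww : y * w - x * w' = 0.
    apply: ann.
      by rewrite mulrBr mulrCA -xv (mulrCA a x) -yv; ring.
    by rewrite mulrBr mulrCA -xu (mulrCA b x) -yu; ring.
  have [|t _ tE] := rxy w; first by exists w' => //; rewrite -[RHS](subrK (x * w')) ww add0r.
  exists t; apply/eqP; rewrite -subr_eq0; apply/eqP/rx.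
    by rewrite mulrBr xu -tE; ring.
  by rewrite mulrBr xv -tE; ring.
split=> //; first exact: local_nzd lR mb rab.
by apply: local_nzd lR ma _ => u v /esym/rab[t -> ->]; exists t.
Qed.

(** A positive value is not the default 0, so it is a genuine least upper bound; if it were not
    attained, its predecessor would be an upper bound too. *)
Lemma supremum_nat_mem (S : set nat) n : supremum 0%N S = n.+1 -> S n.+1.
Proof.
rewrite /supremum; case: ifP => // _; case: xgetP => // k _ [ub lb] kE; subst k.
apply: contrapT => nS; suff /lb : ubound S n by rewrite leEnat ltnn.
move=> i Si; rewrite leEnat -ltnS ltn_neqAle -leEnat ub // andbT.
by apply/eqP => iE; apply: nS; rewrite -iE.
Qed.

Lemma cohen_macaulay_regular (R : comNzRingType) (m : set R) :
  cohen_macaulay_local m -> krull_dim R = 2%N ->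
  exists x y, [/\ m x, m y, forall u, x * u = 0 -> u = 0
                & forall u, principal x (y * u) -> principal x u].
Proof.
move=> [_ dE] d2; have [s [ss sm [_ reg]]] := supremum_nat_mem (etrans dE d2).
case: s ss sm reg => [|x [|y []]] //= _ sm reg.
have gen1 u : principal x u <-> ideal_gen [:: x] u.
  split=> [[w _ <-]|[c ->]]; last first.
    by rewrite big_ord1 /=; exists (c ord0); rewrite // mulrC.
  by exists (fun=> w); rewrite big_ord1 mulrC.
exists x, y; split; [by apply: sm; rewrite !inE eqxx|
                     by apply: sm; rewrite !inE eqxx orbT| |].
- move=> u xu; have [|c ->] := reg 0%N isT u; last by rewrite big_ord0.
  by exists (fun=> 0); rewrite big_ord0.
- by move=> u /gen1/(reg 1%N isT u)/gen1.
Qed.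

(** * Colengths of [aX + bY] *)

Lemma span_addl (R : comNzRingType) (a b : R) (X Y Z : set R) :
  ideal X -> ideal Y -> ideal Z -> X `<=` Z ->
  span 1 (span a X b Y) a Z = span a Z b Y.
Proof.
move=> iX iY iZ XZ; have iS : ideal (span a Z b Y) by exact: ideal_span.
apply/seteqP; split.
  apply: span_subset => // z; last by move=> Zz; exact: spanl.
  rewrite mul1r; apply: span_subset => // t; last by exact: spanr.
  by move=> Xt; apply: spanl => //; exact: XZ.
move=> _ [z Zz [y Yy <-]]; exists (b * y); first exact: spanr.
by exists z => //; ring.
Qed.

Lemma spanC (R : comNzRingType) (a b : R) (X Y : set R) : span a X b Y = span b Y a X.
Proof.
by apply/seteqP; split=> _ [x ? [y ? <-]]; exists y => //; exists x => //; rewrite addrC.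
Qed.

Lemma span_addr (R : comNzRingType) (a b : R) (X Y Z : set R) :
  ideal X -> ideal Y -> ideal Z -> Y `<=` Z ->
  span 1 (span a X b Y) b Z = span a X b Z.
Proof. by move=> *; rewrite (spanC a b X Y) span_addl // spanC. Qed.

(** From [a u = a x + b y], regularity applied to [a (u - x) = b y] gives [u - x = b t] and
    [y = a t]. *)
Lemma colon_span (R : comNzRingType) (a b : R) (X Y : set R) :
  regular_pair a b -> colon (span a X b Y) a = span 1 X b (colon Y a).
Proof.
move=> [ra _ rab]; apply/seteqP; split=> [u [x Xx [y Yy E]]|_ [x Xx [t Yt <-]]].
  have [|t uE yE] := rab (u - x) y; first by rewrite mulrBr [a * u]mulrC -E; ring.
  exists x => //; exists t; first by rewrite /colon /= mulrC -yE.
  by rewrite -uE; ring.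
by exists x => //; exists (t * a) => //; ring.
Qed.

(** The quotients [(aR + bY) / (aX + bY)] and [(aR + bR) / (aR + bY)] are [R / (X + b(Y : a))] and
    [R / (Y + aR)]. Two more uses of [colen_mul] express these colengths through [X], [Y], [Y : a]
    and the intersection of colons; the colength of [Y : a] cancels. *)
Lemma colen_span (R : comNzRingType) (m : set R) (a b : R) (X Y : set R) :
  local_ring m -> regular_pair a b -> cofinite m X -> cofinite m Y ->
  cofinite m (span a setT b setT) ->
  (colen (span a X b Y) + colen (colon Y a `&` colon X b)
   = colen (span a setT b setT) + colen X + colen Y)%N.
Proof.
move=> lR rab cX cY cab; have [iX _] := cX; have [iY _] := cY.
have cT := cofiniteT m.
have caY : cofinite m (span a setT b Y).
  by apply: cofinite_sub (cofinite_span cX cY cab) _ _;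
    [exact: ideal_span|move=> _ [x _ [y Yy <-]]; exists x => //; exists y].
have := colen_mul a lR (cofinite_span cX cY cab) cT.
rewrite span_addl // setTI colon_span //.
have := colen_mul b lR caY cT.
rewrite span_addr // setTI (spanC a) colon_span; last exact: regular_pair_sym.
have -> : colon setT b = setT by [].
have := colen_mul a lR cY cT; rewrite setTI.
have := colen_mul b lR cX (cofinite_colon a cY).
rewrite (colenT lR); lia.
Qed.

(** Multiplication by [a] on [R / (a a', b)] has cokernel [R / (a, b)], and its image is
    [R / (a', b)] because [(a a', b) : a = (a', b)]. *)
Lemma colen_spanM (R : comNzRingType) (m : set R) (a a' b : R) :
  local_ring m -> regular_pair a b ->
  cofinite m (span a setT b setT) -> cofinite m (span a' setT b setT) ->
  cofinite m (span (a * a') setT b setT) /\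
  (colen (span (a * a') setT b setT)
   = colen (span a setT b setT) + colen (span a' setT b setT))%N.
Proof.
move=> lR [ra rb rab] [i1 c1] [i2 c2].
have cM : cofinite m (span (a * a') setT b setT).
  split=> [|x mx]; first exact: ideal_span.
  have [n [u _ [v _ E]]] := c1 x mx; have [n' [u' _ [v' _ E']]] := c2 x mx.
  exists (n + n')%N; exists (u * u') => //; exists (v * (a' * u' + b * v') + a * u * v') => //.
  by rewrite exprD -E -E'; ring.
split=> //; have := colen_mul a lR cM (cofiniteT m).
rewrite (colenT lR) addn0 setTI => ->.
have -> : span 1 (span (a * a') setT b setT) a setT = span a setT b setT.
  apply/seteqP; split.
    apply: span_subset => // z; last by move=> Zz; exact: spanl.
    by rewrite mul1r; apply: span_subset => // t _; [rewrite -mulrA; exact: spanl|exact: spanr].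
  by move=> _ [z Zz [y Yy <-]]; exists (b * y); [exact: spanr|exists z => //; ring].
congr (_ + colen _)%N; apply/seteqP; split=> [u [x _ [y _ E]]|_ [x _ [y _ <-]]].
  have [|t uE _] := rab (u - a' * x) y; first by rewrite mulrBr [a * u]mulrC -E; ring.
  by exists x => //; exists t => //; rewrite -uE; ring.
by exists x => //; exists (y * a) => //; ring.
Qed.

Lemma colen_spanX (R : comNzRingType) (m : set R) (a b : R) k l :
  local_ring m -> regular_pair a b -> cofinite m (span a setT b setT) ->
  cofinite m (span (a ^+ k) setT (b ^+ l) setT) /\
  colen (span (a ^+ k) setT (b ^+ l) setT) = (k * l * colen (span a setT b setT))%N.
Proof.
move=> lR rab cab.
have span1 c : span 1 setT c setT = setT :> set R.
  by apply: ideal1; [exact: ideal_span|exists 1 => //; exists 0 => //; ring].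
have [ck Ek] : cofinite m (span (a ^+ k) setT b setT) /\
    colen (span (a ^+ k) setT b setT) = (k * colen (span a setT b setT))%N.
  elim: k => [|k [ck Ek]]; first by rewrite span1 (colenT lR); split=> //; exact: cofiniteT.
  by have := colen_spanM lR rab cab ck; rewrite -exprS Ek => -[? ->]; split=> //; ring.
elim: l => [|l [cl El]].
  by rewrite spanC span1 (colenT lR) muln0; split=> //; exact: cofiniteT.
have rk := regular_pair_sym (regular_pairX k 1 rab); rewrite expr1 in rk.
rewrite spanC in ck; rewrite spanC in cl.
have := colen_spanM lR rk ck cl; rewrite -exprS ![span (b ^+ _) _ _ _]spanC El.
by rewrite (spanC b) Ek => -[? ->]; split=> //; ring.
Qed.

(** * Products of ideals *)

Lemma ideal_ideal_mul (R : comNzRingType) (A B : set R) : ideal A -> ideal (A ** B).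
Proof.
case=> A0 AD AM; split.
- by exists 0%N, (fun=> 0), (fun=> 0); split=> [[]|]; rewrite ?big_ord0.
- move=> _ _ [n [u [v [uv ->]]]] [n' [u' [v' [uv' ->]]]].
  exists (n + n')%N, (fun i => match fintype.split i with inl j => u j | inr j => u' j end),
    (fun i => match fintype.split i with inl j => v j | inr j => v' j end).
  split; first by move=> i; case: (fintype.split i).
  rewrite big_split_ord /=; congr (_ + _); apply: eq_bigr => i _.
    by rewrite -[lshift _ _]/(unsplit (inl i)) unsplitK.
  by rewrite -[rshift _ _]/(unsplit (inr i)) unsplitK.
- move=> c _ [n [u [v [uv ->]]]]; exists n, (fun i => c * u i), v; split.
    by move=> i; have [? ?] := uv i; split=> //; exact: AM.
  by rewrite mulr_sumr; apply: eq_bigr => i _; rewrite mulrA.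
Qed.

Lemma ideal_mul_mem (R : comNzRingType) (A B : set R) x y : A x -> B y -> (A ** B) (x * y).
Proof. by move=> Ax By; exists 1%N, (fun=> x), (fun=> y); rewrite big_ord1. Qed.

Lemma ideal_mul_min (R : comNzRingType) (A B C : set R) : ideal C ->
  (forall x y, A x -> B y -> C (x * y)) -> A ** B `<=` C.
Proof.
by move=> iC AB _ [n [u [v [uv ->]]]]; apply: ideal_sum => // i; have [? ?] := uv i; exact: AB.
Qed.

Lemma ideal_mulC (R : comNzRingType) (A B : set R) :
  ideal A -> ideal B -> A ** B = B ** A.
Proof.
by move=> iA iB; apply/seteqP; split; apply: ideal_mul_min; try exact: ideal_ideal_mul;
  move=> x y ? ?; rewrite mulrC; exact: ideal_mul_mem.
Qed.

Lemma ideal_mulA (R : comNzRingType) (A B C : set R) :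
  ideal A -> ideal B -> ideal C -> A ** (B ** C) = A ** B ** C.
Proof.
move=> iA iB iC; have iAB := ideal_ideal_mul B iA.
have iL := ideal_ideal_mul (B ** C) iA; have iE := ideal_ideal_mul C iAB.
apply/seteqP; split; apply: ideal_mul_min => // x y.
  (* With one factor fixed, the admissible values of the other form a colon ideal, so products of
     generators suffice. *)
  move=> Ax BCy; rewrite mulrC; have : colon (A ** B ** C) x y; last by [].
  apply: ideal_mul_min BCy; first exact: ideal_colon.
  move=> b c Bb Cc; rewrite /colon /= mulrC mulrA.
  by apply: ideal_mul_mem => //; exact: ideal_mul_mem.
move=> ABx Cy; have : colon (A ** (B ** C)) y x; last by [].
apply: ideal_mul_min ABx; first exact: ideal_colon.
move=> a b Aa Bb; rewrite /colon /= -mulrA.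
by apply: ideal_mul_mem => //; exact: ideal_mul_mem.
Qed.

Lemma ideal_mulTi (R : comNzRingType) (A : set R) : ideal A -> setT ** A = A.
Proof.
move=> iA; apply/seteqP; split=> [|x Ax].
  by apply: ideal_mul_min => // x y _; case: iA => _ _; exact.
by rewrite -[x]mul1r; exact: ideal_mul_mem.
Qed.

Lemma ideal_mulACA (R : comNzRingType) (A B C D : set R) :
  ideal A -> ideal B -> ideal C -> ideal D ->
  A ** B ** (C ** D) = A ** C ** (B ** D).
Proof.
move=> iA iB iC iD; have iM := ideal_ideal_mul.
rewrite -!ideal_mulA; [|by auto..]; congr (_ ** _).
by rewrite !ideal_mulA // (ideal_mulC iB).
Qed.

Lemma ideal_ideal_exp (R : comNzRingType) (A : set R) n : ideal A -> ideal (A ^^ n).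
Proof. by move=> iA; case: n => [|n] //=; exact: ideal_ideal_mul. Qed.

Lemma ideal_expD (R : comNzRingType) (A : set R) m n :
  ideal A -> A ^^ (m + n) = A ^^ m ** A ^^ n.
Proof.
move=> iA; have iE k := ideal_ideal_exp k iA.
elim: m => [|m IH]; first by rewrite ideal_mulTi.
by rewrite addSn /= IH ideal_mulA.
Qed.

Lemma ideal_expM (R : comNzRingType) (A B : set R) n :
  ideal A -> ideal B -> (A ** B) ^^ n = A ^^ n ** B ^^ n.
Proof.
move=> iA iB; elim: n => [|n IH] /=; first by rewrite ideal_mulTi.
by rewrite IH ideal_mulACA //; exact: ideal_ideal_exp.
Qed.

Lemma ideal_exp_mem (R : comNzRingType) (A : set R) a n : A a -> (A ^^ n) (a ^+ n).
Proof. by move=> Aa; elim: n => [|n IH] //; rewrite exprS; exact: ideal_mul_mem. Qed.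

Lemma cofinite_mul (R : comNzRingType) (m A B : set R) :
  cofinite m A -> cofinite m B -> cofinite m (A ** B).
Proof.
move=> [iA rA] [iB rB]; split=> [|x mx]; first exact: ideal_ideal_mul.
have [n An] := rA x mx; have [k Bk] := rB x mx; exists (n + k)%N.
by rewrite exprD; exact: ideal_mul_mem.
Qed.

Lemma cofinite_exp (R : comNzRingType) (m A : set R) n :
  cofinite m A -> cofinite m (A ^^ n).
Proof.
by move=> cA; elim: n => [|n IH] /=; [exact: cofiniteT|exact: cofinite_mul].
Qed.

Lemma cofinite_primary (R : comNzRingType) (m I : set R) :
  primary_to m I -> cofinite m I.
Proof. by case=> iI _ _ rI; split=> // x; rewrite -rI. Qed.

Lemma primary_sub (R : comNzRingType) (m I : set R) : primary_to m I -> I `<=` m.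
Proof. by case=> _ _ _ <- x Ix; exists 1%N. Qed.

(** * Joint reductions *)

Definition biexp (R : comNzRingType) (I J : set R) r s : set R := I ^^ r ** J ^^ s.

Lemma ideal_biexp (R : comNzRingType) (I J : set R) r s :
  ideal I -> ideal (biexp I J r s).
Proof. by move=> iI; exact/ideal_ideal_mul/ideal_ideal_exp. Qed.

Lemma cofinite_biexp (R : comNzRingType) (m I J : set R) r s :
  cofinite m I -> cofinite m J -> cofinite m (biexp I J r s).
Proof. by move=> *; apply: cofinite_mul; exact: cofinite_exp. Qed.

Lemma biexpD (R : comNzRingType) (I J : set R) r s r' s' : ideal I -> ideal J ->
  biexp I J (r + r') (s + s') = biexp I J r s ** biexp I J r' s'.
Proof.
move=> iI iJ; rewrite /biexp !ideal_expD // ideal_mulACA //; exact: ideal_ideal_exp.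
Qed.

Lemma biexp_mulX (R : comNzRingType) (I J : set R) a b r s k l x :
  ideal I -> ideal J -> I a -> J b -> biexp I J r s x ->
  biexp I J (r + k) (s + l) (a ^+ k * b ^+ l * x).
Proof.
move=> iI iJ Ia Jb Px; rewrite biexpD // [_ * x]mulrC; apply: ideal_mul_mem => //.
by apply: ideal_mul_mem; exact: ideal_exp_mem.
Qed.

Lemma biexp_mulXl (R : comNzRingType) (I J : set R) a r s k x :
  ideal I -> ideal J -> I a -> biexp I J r s x -> biexp I J (r + k) s (a ^+ k * x).
Proof.
move=> iI iJ Ia Px; have [J0 _ _] := iJ.
by have := @biexp_mulX _ I J a 0 r s k 0 x iI iJ Ia J0 Px; rewrite addn0 expr0 mulr1.
Qed.

Lemma biexp_mulXr (R : comNzRingType) (I J : set R) b r s l x :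
  ideal I -> ideal J -> J b -> biexp I J r s x -> biexp I J r (s + l) (b ^+ l * x).
Proof.
move=> iI iJ Jb Px; have [I0 _ _] := iI.
by have := @biexp_mulX _ I J 0 b r s 0 l x iI iJ I0 Jb Px; rewrite addn0 expr0 mul1r.
Qed.

(** For [k = l] this is the denominator of [M1]. Independent exponents are kept so that lengths can
    be compared as polynomials in two variables. *)
Definition koszul_image (R : comNzRingType) (I J : set R) (a b : R) r s k l : set R :=
  span (a ^+ k) (biexp I J r (s + l)) (b ^+ l) (biexp I J (r + k) s).

Lemma koszul_image_sub (R : comNzRingType) (I J : set R) a b r s k l :
  ideal I -> ideal J -> I a -> J b ->
  koszul_image I J a b r s k l `<=` biexp I J (r + k) (s + l).
Proof.
move=> iI iJ Ia Jb; apply: span_subset; first exact: ideal_biexp.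
  by move=> x; exact: biexp_mulXl.
by move=> x; exact: biexp_mulXr.
Qed.

Lemma joint_reduction_atE (R : comNzRingType) (I J : set R) a b r s :
  joint_reduction_at I J a b r s <->
  biexp I J (r + 1) (s + 1) = koszul_image I J a b r s 1 1.
Proof. by rewrite /joint_reduction_at /koszul_image /span !expr1 !addn1. Qed.

(** Multiply the equation at [(r, s)] by [I^i J^j]. *)
Lemma joint_reduction_at_add (R : comNzRingType) (I J : set R) a b r s i j :
  ideal I -> ideal J -> I a -> J b -> joint_reduction_at I J a b r s ->
  joint_reduction_at I J a b (r + i) (s + j).
Proof.
move=> iI iJ Ia Jb /joint_reduction_atE E; apply/joint_reduction_atE.
apply/seteqP; split; last exact: koszul_image_sub.
have iK : ideal (koszul_image I J a b (r + i) (s + j) 1 1).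
  by apply: ideal_span; exact: ideal_biexp.
rewrite ![(_ + _ + 1)%N]addnAC biexpD //; apply: ideal_mul_min => // u v.
rewrite E => -[x Px [y Py <-]] Pv; exists (x * v).
  by rewrite addnAC biexpD //; exact: ideal_mul_mem.
exists (y * v); last by ring.
by rewrite addnAC biexpD //; exact: ideal_mul_mem.
Qed.

(** Double induction. The equation at [(r + k, s + l)] splits an element into an [a]-part, handled
    by the hypothesis for [k] at [l.+1], and a [b]-part, handled by the one for [l] at [k.+1]. A
    zero exponent contributes the factor 1. *)
Lemma joint_reduction_at_powers (R : comNzRingType) (I J : set R) a b r s k l :
  ideal I -> ideal J -> I a -> J b -> joint_reduction_at I J a b r s ->
  biexp I J (r + k) (s + l) = koszul_image I J a b r s k l.
Proof.
move=> iI iJ Ia Jb jr; apply/seteqP; split; last exact: koszul_image_sub.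
have iP p q : ideal (biexp I J p q) by exact: ideal_biexp.
have iK p q : ideal (koszul_image I J a b r s p q) by exact: ideal_span.
elim: k l => [|k IHk] l.
  by rewrite addn0 => x Px; rewrite -[x]mul1r; exact: spanl.
elim: l => [|l IHl].
  by rewrite addn0 => x Px; rewrite -[x]mul1r; exact: spanr.
have /joint_reduction_atE := joint_reduction_at_add k l iI iJ Ia Jb jr.
rewrite -!addnA !addn1 => ->; apply: span_subset => // x; rewrite expr1.
  rewrite addn1 -addnS => /(IHk l.+1)[u Pu [v Pv <-]]; exists u => //.
  exists (a * v); last by rewrite exprS; ring.
  by have := biexp_mulXl 1 iI iJ Ia Pv; rewrite expr1 -addnA addn1.
rewrite addn1 -addnS => /IHl[u Pu [v Pv <-]]; exists (b * u).
  by have := biexp_mulXr 1 iI iJ Jb Pu; rewrite expr1 -addnA addn1.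
by exists v => //; rewrite !exprS; ring.
Qed.

(** The ideal [F_{k,l}]; [Ftilde] is the union of its diagonal members with [k >= 1]. *)
Definition biexp_colon (R : comNzRingType) (I J : set R) (a b : R) r s k l : set R :=
  colon (biexp I J (r + k) s) (a ^+ k) `&` colon (biexp I J r (s + l)) (b ^+ l).

Lemma sub_biexp_colon (R : comNzRingType) (I J : set R) a b r s k l :
  ideal I -> ideal J -> I a -> J b ->
  biexp I J r s `<=` biexp_colon I J a b r s k l.
Proof.
move=> iI iJ Ia Jb x Px; split; rewrite /colon /= mulrC.
  exact: biexp_mulXl.
exact: biexp_mulXr.
Qed.

(** Each colon ideal increases with its own exponent, so the intersection is constant once both
    exponents are large. *)
Lemma biexp_colon_stationary (R : comNzRingType) (I J : set R) a b r s :
  noetherian R -> ideal I -> ideal J -> I a -> J b ->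
  exists F K, forall k l, (K <= k)%N -> (K <= l)%N -> biexp_colon I J a b r s k l = F.
Proof.
move=> nR iI iJ Ia Jb.
pose U k := colon (biexp I J (r + k) s) (a ^+ k).
pose V l := colon (biexp I J r (s + l)) (b ^+ l).
have [||K UK] := @noetherian_stationary _ U nR.
- by move=> k; exact/ideal_colon/ideal_biexp.
- move=> k x; rewrite /U /colon /= => /(biexp_mulXl 1 iI iJ Ia).
  by rewrite expr1 -addnA addn1 exprS mulrCA.
have [||L VL] := @noetherian_stationary _ V nR.
- by move=> l; exact/ideal_colon/ideal_biexp.
- move=> l x; rewrite /V /colon /= => /(biexp_mulXr 1 iI iJ Jb).
  by rewrite expr1 -addnA addn1 exprS mulrCA.
exists (U K `&` V L), (maxn K L) => k l; rewrite !geq_max => /andP[lk _] /andP[_ ll].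
by rewrite -(UK k) // -(VL l).
Qed.

(** The equation at [(N, N)] puts [I^(N+1) J^(N+1)] inside [(a, b)], which is therefore cofinite. It
    then contains powers of a regular sequence [x, y], and [regular_pair_of_span] applies to these
    powers. *)
Lemma joint_reduction_regular (R : comNzRingType) (m I J : set R) a b :
  cohen_macaulay_local m -> krull_dim R = 2%N -> primary_to m I -> primary_to m J ->
  joint_reduction I J a b ->
  regular_pair a b /\ cofinite m (span a setT b setT).
Proof.
move=> CM dim2 pI pJ [Ia Jb [N jr]]; have [lR _] := CM.
have iab : ideal (span a setT b setT) by exact: ideal_span.
have cab : cofinite m (span a setT b setT).
  apply: cofinite_sub (cofinite_biexp (N + 1) (N + 1) (cofinite_primary pI) (cofinite_primary pJ)) iab _.
  have /joint_reduction_atE -> := jr N N (leqnn _) (leqnn _).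
  by rewrite /koszul_image !expr1 => _ [x _ [y _ <-]]; exists x => //; exists y.
split=> //; have [x [y [mx my rx rxy]]] := cohen_macaulay_regular CM dim2.
have [k xk] := cab.2 x mx; have [l yl] := cab.2 y my.
have [rxk rxyk] := regular_powers k l rx rxy.
by apply: regular_pair_of_span lR _ _ rxk rxyk xk yl; [exact: (primary_sub pI)|exact: (primary_sub pJ)].
Qed.

Lemma colen_koszul_image (R : comNzRingType) (m I J : set R) a b r s k l :
  local_ring m -> cofinite m I -> cofinite m J -> regular_pair a b ->
  cofinite m (span a setT b setT) ->
  cofinite m (koszul_image I J a b r s k l) /\
  (colen (koszul_image I J a b r s k l) + colen (biexp_colon I J a b r s k l)
   = k * l * colen (span a setT b setT) + colen (biexp I J r (s + l))
     + colen (biexp I J (r + k) s))%N.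
Proof.
move=> lR cI cJ rab cab; have [cakl <-] := colen_spanX k l lR rab cab.
split; first by apply: cofinite_span => //; exact: cofinite_biexp.
by apply: (colen_span lR (regular_pairX k l rab)) => //; exact: cofinite_biexp.
Qed.

Lemma nzd_descent (R : comNzRingType) (a : R) (P : nat -> set R) :
  (forall k x, P k.+1 (a * x) -> P k x) ->
  forall j i x, P (i + j)%N (a ^+ j * x) -> P i x.
Proof.
move=> desc; elim=> [|j IH] i x; first by rewrite addn0 mul1r.
by rewrite addnS exprS -mulrA => /desc/IH.
Qed.

(** Write [a^k b^k x = a^(k+1) u + b^(k+1) v]. Regularity of powers gives first [v = a^k t] and
    [b^k x - a u = b^(k+1) t], then [u = b^k t'] and [x = a t' + b t]. The two cancellation
    hypotheses place [t] and [t'] in the right products. *)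
Lemma joint_reduction_at_descent (R : comNzRingType) (I J : set R) a b r s k :
  ideal I -> ideal J -> I a -> J b -> regular_pair a b ->
  (forall k x, biexp I J (r + k.+1) s (a * x) -> biexp I J (r + k) s x) ->
  (forall k x, biexp I J r (s + k.+1) (b * x) -> biexp I J r (s + k) x) ->
  biexp I J (r + k.+1) (s + k.+1) = koszul_image I J a b r s k.+1 k.+1 ->
  joint_reduction_at I J a b r s.
Proof.
move=> iI iJ Ia Jb rab Ha Hb E; apply/joint_reduction_atE.
apply/seteqP; split; last exact: koszul_image_sub.
move=> x Px; have := biexp_mulX k k iI iJ Ia Jb Px.
rewrite -!addnA !add1n E => -[u Pu [v Pv uvE]].
have [_ _ rakb] := regular_pairX k k.+1 rab.
have [|t xE vE] := rakb (b ^+ k * x - a * u) v.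
  by rewrite mulrBr [_ * (_ * x)]mulrA -uvE !exprS; ring.
have [_ _ rbka] := regular_pairX 1 k rab.
have [|t' uE xE'] := rbka u (x - b * t).
  by rewrite mulrBr (mulrA (b ^+ k) b) -exprSr -xE; ring.
exists t'.
  by apply: (nzd_descent (P := fun i => biexp I J r (s + i)) Hb (j := k)); rewrite add1n -uE.
exists t; last by rewrite -[RHS](subrK (b * t)) xE'.
by apply: (nzd_descent (P := fun i => biexp I J (r + i) s) Ha (j := k)); rewrite add1n -vE.
Qed.

Lemma zero_moduleP (R : comNzRingType) (A B : set R) :
  ideal A -> ideal B -> zero_module (B /// A) <-> B `<=` A.
Proof.
move=> iA [B0 _ _]; have [A0 AD _] := iA; split=> [Z x Bx|BA].
  have : cosets (B /// A) [set x + y | y in A] by exists x.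
  rewrite Z => E; have : [set x + y | y in A] x by exists 0; rewrite ?addr0.
  by rewrite E.
have cE x : A x -> [set x + y | y in A] = A.
  move=> Ax; apply/seteqP; split=> [_ [y Ay <-]|y Ay]; first exact: AD.
  by exists (y - x); [exact: idealB|ring].
apply/seteqP; split=> [_ [x Bx <-]|_ ->] /=; first by rewrite cE //; exact: BA.
by exists 0 => //; exact: cE.
Qed.

(** * Hilbert coefficients *)

Lemma double_binS (n : nat) : 2%:Z * 'C(n + 1, 2)%:Z = n%:Z * (n%:Z + 1).
Proof.
by have := mul_bin_diag n.+1 1; rewrite bin1 addn1 /=; lia.
Qed.

Lemma int_quadratic0 (x y z : int) (K : nat) :
  (forall n, (K <= n)%N -> x * 'C(n + 1, 2)%:Z + y * n%:Z + z = 0) ->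
  [/\ x = 0, y = 0 & z = 0].
Proof.
move=> f0; pose t := K%:Z.
have f0' i : x * ((t + i%:Z) * (t + i%:Z + 1)) + 2 * (y * (t + i%:Z)) + 2 * z = 0.
  have := f0 (K + i)%N (leq_addr _ _); have := double_binS (K + i).
  by rewrite PoszD -/t; nia.
(* Three consecutive values determine a quadratic; the relation was doubled to clear the
   binomial. *)
have := f0' 0%N; have := f0' 1%N; have := f0' 2%N; clearbody t => e2 e1 e0.
have x0 : x = 0 by lia.
have y0 : y = 0 by move: e0 e1 e2; rewrite x0; lia.
by split=> //; move: e0; rewrite x0 y0; lia.
Qed.

Lemma int_biquadratic0 (w x x' y y' z : int) (r s K : nat) :
  (forall k l, (K <= k)%N -> (K <= l)%N ->
    w * (k%:Z * l%:Z) + x * 'C(r + k + 1, 2)%:Z + x' * 'C(s + l + 1, 2)%:Z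
    + y * k%:Z + y' * l%:Z + z = 0) ->
  [/\ w = 0, x = 0, x' = 0, y = 0 & y' = 0] /\ z = 0.
Proof.
move=> f0.
(* The mixed second difference at [K], [K + 1] isolates [w]. Afterwards one variable is frozen at
   [K], and the other is shifted by [r] or [s] to match the binomial. *)
have w0 : w = 0.
  have := f0 K K (leqnn _) (leqnn _); have := f0 K.+1 K.+1 (leqnSn _) (leqnSn _).
  have := f0 K K.+1 (leqnn _) (leqnSn _); have := f0 K.+1 K (leqnSn _) (leqnn _).
  lia.
have [|x0 y0 _] := @int_quadratic0 x y
    (x' * 'C(s + K + 1, 2)%:Z + y' * K%:Z + z - y * r%:Z) (r + K).
  move=> n len; have := f0 (n - r)%N K; rewrite subnKC; last by lia.
  have -> : (n - r)%N%:Z = n%:Z - r%:Z by lia.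
  by rewrite w0; lia.
have [|x0' y0' z0] := @int_quadratic0 x' y' (z - y' * s%:Z) (s + K).
  move=> n len; have := f0 K (n - s)%N; rewrite subnKC; last by lia.
  have -> : (n - s)%N%:Z = n%:Z - s%:Z by lia.
  by rewrite w0 x0 y0; lia.
by split=> //; move: z0; rewrite y0'; lia.
Qed.

Lemma bigraded_hilbert_coefE (R : comNzRingType) (I J : set R) e :
  bigraded_hilbert_coef I J e -> exists N, forall r s, (N <= r)%N -> (N <= s)%N ->
  (colen (biexp I J r s))%:Z =
    e 2%N 0%N * 'C(r + 1, 2)%:Z + e 0%N 2%N * 'C(s + 1, 2)%:Z
    + e 1%N 1%N * (r%:Z * s%:Z) - e 1%N 0%N * r%:Z - e 0%N 1%N * s%:Z + e 0%N 0%N.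
Proof.
move=> [N eN]; exists N => r s ler les; have := eN r s ler les; rewrite /colength => ->.
under eq_bigr do rewrite big_mkcond !big_ord_recl big_ord0 /=.
rewrite !big_ord_recl big_ord0 /=.
(* The subtraction in [r + i - 1] can truncate only for [i = 0], where the binomial is 1 anyway;
   likewise for [s + j - 1]. *)
rewrite /bump /= !addn0 !bin0 !addnK !bin1 -!addnBA // -[(1 + 1)%N]/2%N subn1 /=.
ring.
Qed.

Lemma hilbert_coef_e2 (R : comNzRingType) (I J : set R) eIJ e :
  ideal I -> ideal J ->
  hilbert_coef (I ** J) eIJ -> bigraded_hilbert_coef I J e -> eIJ 2%N = e 0%N 0%N.
Proof.
move=> iI iJ [N eN] /bigraded_hilbert_coefE[N' eN'].
pose w := e 1%N 1%N.
(* On the diagonal the mixed term is [w n^2 = 2 w C(n+1, 2) - w n], so it leaves the constant term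
   alone. *)
have [|_ _ z0] := @int_quadratic0 (e 2%N 0%N + e 0%N 2%N + 2 * w - eIJ 0%N)
  (eIJ 1%N - e 1%N 0%N - e 0%N 1%N - w) (e 0%N 0%N - eIJ 2%N) (maxn N N').
- move=> n; rewrite geq_max => /andP[leN leN'].
  have := eN n leN; have := eN' n n leN' leN'.
  rewrite ideal_expM // /colength -/(colen _) -/(biexp I J n n) -/w => ->.
  by have := double_binS n; nia.
- by lia.
Qed.

(* [c] is the colength of [biexp_colon] for large exponents. *)
Lemma hilbert_coef_joint (R : comNzRingType) (I J : set R) (e0I e0J : int)
    (e : nat -> nat -> int) (g1 g2 h1 h2 : nat -> int) r s (c L : int) K :
  bigraded_hilbert_coef I J e ->
  fixed_left_coef I J e0J g1 g2 -> fixed_right_coef I J e0I h1 h2 ->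
  (forall k l, (K <= k)%N -> (K <= l)%N ->
    (colen (biexp I J (r + k) (s + l)))%:Z + c = k%:Z * l%:Z * L
     + (colen (biexp I J r (s + l)))%:Z + (colen (biexp I J (r + k) s))%:Z) ->
  [/\ L = e 1%N 1%N, e0I = e 2%N 0%N, e0J = e 0%N 2%N,
      e 0%N 1%N = g1 r + r%:Z * e 1%N 1%N & e 1%N 0%N = h1 s + s%:Z * e 1%N 1%N]
  /\ e 0%N 0%N = g2 r + h2 s - c + r%:Z * s%:Z * e 1%N 1%N.
Proof.
move=> /bigraded_hilbert_coefE[N eN] /(_ r)[N1 gN] /(_ s)[N2 hN] cE.
(* The constant term left after expanding in [C(r+k+1, 2)], [C(s+l+1, 2)], [k l], [k] and [l]. *)
pose z := g2 r - g1 r * s%:Z + h2 s - h1 s * r%:Z - c - e 0%N 0%N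
  + e 1%N 0%N * r%:Z + e 0%N 1%N * s%:Z - e 1%N 1%N * (r%:Z * s%:Z).
have [|[w0 x0 x0' y0 y0'] z0] := @int_biquadratic0 (L - e 1%N 1%N) (e0I - e 2%N 0%N)
  (e0J - e 0%N 2%N) (e 1%N 0%N - h1 s - e 1%N 1%N * s%:Z)
  (e 0%N 1%N - g1 r - e 1%N 1%N * r%:Z) z r s (maxn K (maxn N (maxn N1 N2))).
  move=> k l; rewrite !geq_max => /and4P[kK kN _ kN2] /and4P[lK lN lN1 _].
  have := cE k l kK lK.
  rewrite (eN (r + k)%N (s + l)%N); [|by lia..].
  have := gN (s + l)%N; rewrite /colength -/(colen _) -/(biexp _ _ _ _) => ->; last by lia.
  have := hN (r + k)%N; rewrite /colength -/(colen _) -/(biexp _ _ _ _) => ->; last by lia.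
  by rewrite /z !PoszD; lia.
by split; first split; move: z0; rewrite /z; lia.
Qed.

(** Evaluated at [(N, N)], where the equation is available for this pair. Consequently all joint
    reductions have the same colength, which allows two of them to be compared. *)
Lemma joint_reduction_coef (R : comNzRingType) (m I J : set R) (e0I e0J : int)
    (e : nat -> nat -> int) (g1 g2 h1 h2 : nat -> int) a b :
  cohen_macaulay_local m -> krull_dim R = 2%N -> primary_to m I -> primary_to m J ->
  bigraded_hilbert_coef I J e ->
  fixed_left_coef I J e0J g1 g2 -> fixed_right_coef I J e0I h1 h2 ->
  joint_reduction I J a b ->
  [/\ (colen (span a setT b setT))%:Z = e 1%N 1%N, e0I = e 2%N 0%N & e0J = e 0%N 2%N].
Proof.
move=> CM dim2 pI pJ he hg hh jr.
have [rab cab] := joint_reduction_regular CM dim2 pI pJ jr.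
have cI := cofinite_primary pI; have cJ := cofinite_primary pJ.
have [iI _] := cI; have [iJ _] := cJ; have [lR _] := CM; have [nR _ _] := lR.
have [Ia Jb [N jrN]] := jr.
have [F [K FK]] := biexp_colon_stationary N N nR iI iJ Ia Jb.
have [|[-> -> -> _ _] _] := @hilbert_coef_joint _ I J e0I e0J e g1 g2 h1 h2 N N
    (colen F)%:Z (colen (span a setT b setT))%:Z K he hg hh; last by [].
move=> k l lek lel; rewrite (joint_reduction_at_powers k l iI iJ Ia Jb (jrN N N _ _)) //.
by have [_] := colen_koszul_image N N k l lR cI cJ rab cab; rewrite FK //; lia.
Qed.

Theorem theorem3p33 (R : comNzRingType) (m : set R)
    (hCM : cohen_macaulay_local m) (hdim : krull_dim R = 2%N)
    (hres : infinite_set (cosets (setT /// m)))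
    (I J : set R) (hI : primary_to m I) (hJ : primary_to m J)
    (eI eJ eIJ : nat -> int) (e : nat -> nat -> int) (g1 g2 h1 h2 : nat -> int)
    (heI : hilbert_coef I eI) (heJ : hilbert_coef J eJ)
    (heIJ : hilbert_coef (I ** J) eIJ) (he : bigraded_hilbert_coef I J e)
    (hg : fixed_left_coef I J (eJ 0%N) g1 g2)
    (hh : fixed_right_coef I J (eI 0%N) h1 h2)
    (r0 s0 : nat) (a b : R) (hab : joint_reduction I J a b)
    (ha : forall k, (1 <= k)%N ->
      principal a `&` (I ^^ (r0 + k) ** J ^^ s0) =
      [set a * x | x in I ^^ (r0 + k - 1) ** J ^^ s0])
    (hb : forall k, (1 <= k)%N ->
      principal b `&` (I ^^ r0 ** J ^^ (s0 + k)) =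
      [set b * x | x in I ^^ r0 ** J ^^ (s0 + k - 1)]) :
  [<-> joint_reduction_lattice I J (r0, s0);
       [/\ e 0%N 1%N = g1 r0 + r0%:Z * e 1%N 1%N,
           e 1%N 0%N = h1 s0 + s0%:Z * e 1%N 1%N
         & eIJ 2%N = g2 r0 + h2 s0 - colength (I ^^ r0 ** J ^^ s0)
                     + r0%:Z * s0%:Z * e 1%N 1%N
                     + (length (Ftilde I J a b r0 s0 ///
                                (I ^^ r0 ** J ^^ s0)))%:Z];
       forall k, (1 <= k)%N -> zero_module (M1 I J a b r0 s0 k)].
Proof.
have cI := cofinite_primary hI; have cJ := cofinite_primary hJ.
have [iI _] := cI; have [iJ _] := cJ; have [lR _] := hCM.
have [rab cab] := joint_reduction_regular hCM hdim hI hJ hab.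
have [Ia Jb _] := hab; have [ra rb _] := rab.
have iP r s : ideal (biexp I J r s) by exact: ideal_biexp.
have cP r s : cofinite m (biexp I J r s) by exact: cofinite_biexp.
have cancel (c x y : R) : (forall u, c * u = 0 -> u = 0) -> c * x = c * y -> x = y.
  by move=> rc E; apply/eqP; rewrite -subr_eq0; apply/eqP/rc; rewrite mulrBr E subrr.
(* The intersection hypotheses act as cancellation rules: dividing by [a] (here) or by [b] (next)
   lowers the corresponding exponent by one. *)
have Ha k x : biexp I J (r0 + k.+1) s0 (a * x) -> biexp I J (r0 + k) s0 x.
  move=> Px; have : (principal a `&` (I ^^ (r0 + k.+1) ** J ^^ s0)) (a * x).
    by split=> //; exists x.
  by rewrite ha // addnS subn1 => -[y Py /(cancel _ _ _ ra) <-].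
have Hb k x : biexp I J r0 (s0 + k.+1) (b * x) -> biexp I J r0 (s0 + k) x.
  move=> Px; have : (principal b `&` (I ^^ r0 ** J ^^ (s0 + k.+1))) (b * x).
    by split=> //; exists x.
  by rewrite hb // addnS subn1 => -[y Py /(cancel _ _ _ rb) <-].
have FP k l : biexp_colon I J a b r0 s0 k l = biexp I J r0 s0.
  apply/seteqP; split; last exact: sub_biexp_colon.
  move=> x [xa _]; rewrite -[r0]addn0.
  apply: (nzd_descent (P := fun i => biexp I J (r0 + i) s0) Ha (j := k)).
  by rewrite add0n mulrC.
have FtP : Ftilde I J a b r0 s0 = biexp I J r0 s0.
  apply/seteqP; split=> [x [k _ xk]|x Px]; first by rewrite -(FP k k).
  by exists 1%N => //; rewrite -/(biexp_colon I J a b r0 s0 1 1) FP.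
(* The last length in (b) thus vanishes. *)
have L0 : length (Ftilde I J a b r0 s0 /// (I ^^ r0 ** J ^^ s0)) = 0%N.
  rewrite FtP -/(biexp I J r0 s0).
  by have [_] := colen_sub lR (cP r0 s0) (iP r0 s0) (@subset_refl _ _); lia.
have e2E := hilbert_coef_e2 iI iJ heIJ he.
have [LE eI0 eJ0] := joint_reduction_coef hCM hdim hI hJ he hg hh hab.
have kos k l := colen_koszul_image r0 s0 k l lR cI cJ rab cab.
have zeroM k : zero_module (M1 I J a b r0 s0 k) <->
    biexp I J (r0 + k) (s0 + k) = koszul_image I J a b r0 s0 k k.
  rewrite /M1 -/(biexp _ _ _ _) -/(span _ _ _ _) -/(koszul_image I J a b r0 s0 k k).
  have [[iK _] _] := kos k k.
  apply: iff_trans (zero_moduleP iK (iP _ _)) _; split=> [PK|->//].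
  by apply/seteqP; split=> //; exact: koszul_image_sub.
rewrite L0 e2E addr0; tfae.
- move=> [a' [b' [jr' /= jr0]]].
  have [rab' cab'] := joint_reduction_regular hCM hdim hI hJ jr'.
  have [LE' _ _] := joint_reduction_coef hCM hdim hI hJ he hg hh jr'.
  have [Ia' Jb' _] := jr'.
  have [|[_ _ _ -> ->] ->] // := @hilbert_coef_joint _ I J (eI 0%N) (eJ 0%N) e g1 g2 h1 h2
    r0 s0 (colen (biexp I J r0 s0))%:Z (e 1%N 1%N) 0%N he hg hh.
  move=> k l _ _; have [cK E] := kos k l.
  have [cK' E'] := colen_koszul_image r0 s0 k l lR cI cJ rab' cab'.
  have jrE := joint_reduction_at_powers k l iI iJ Ia' Jb' jr0.
  (* Squeeze: the right-hand sides of [E] and [E'] agree, while [le1] and [le2] bound each term on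
     the left of [E'] by its counterpart in [E]. Both bounds are therefore equalities, for all [k]
     and [l]. *)
  have le1 := colen_le lR cK (iP _ _) (@koszul_image_sub _ _ _ _ _ r0 s0 k l iI iJ Ia Jb).
  have iF' : ideal (biexp_colon I J a' b' r0 s0 k l).
    by apply: idealI; apply: ideal_colon.
  have le2 := colen_le lR (cP _ _) iF' (@sub_biexp_colon _ _ _ _ _ r0 s0 k l iI iJ Ia' Jb').
  move: E E' LE LE' le1 le2; rewrite FP -jrE.
  set L := colen (span a _ _ _); set L' := colen (span a' _ _ _) => E E' LE LE'.
  have LL : L' = L by apply/eqP; rewrite -eqz_nat LE LE'.
  by rewrite -LE; move: E E'; rewrite LL; lia.
- move=> [e01 e10 e00].
  have [N eN] := bigraded_hilbert_coefE he; have [N1 gN] := hg r0; have [N2 hN] := hh s0.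
  have jrk k : (maxn N (maxn N1 N2) <= k)%N ->
      biexp I J (r0 + k) (s0 + k) = koszul_image I J a b r0 s0 k k.
    rewrite !geq_max => /and3P[leN leN1 leN2]; apply/esym; have [cK E] := kos k k.
    (* An inclusion of cofinite ideals with equal colengths is an equality; (b) supplies the
       equality for large [k]. *)
    apply: colen_eq lR cK (iP _ _) (@koszul_image_sub _ _ _ _ _ _ _ _ _ iI iJ Ia Jb) _.
    rewrite -lez_nat (eN (r0 + k)%N (s0 + k)%N); [|by lia..].
    have := gN (s0 + k)%N; rewrite /colength -/(colen _) -/(biexp _ _ _ _) => /(_ _)gE.
    have := hN (r0 + k)%N; rewrite /colength -/(colen _) -/(biexp _ _ _ _) => /(_ _)hE.
    have {}gE := gE ltac:(lia); have {}hE := hE ltac:(lia).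
    move: E; rewrite FP => /(congr1 Posz); rewrite !PoszD !PoszM LE gE hE.
    move: e00; rewrite /colength -/(colen _) -/(biexp _ _ _ _).
    by rewrite e01 e10 eI0 eJ0 !PoszD => ->; lia.
  (* The successor of the threshold is used because the descent starts from an exponent [k.+1]. The
     equation for [(a, b)] at [(r0, s0)] then gives every [k]. *)
  have jr0 := joint_reduction_at_descent iI iJ Ia Jb rab Ha Hb (jrk _ (leqnSn _)).
  by move=> i _; apply/zeroM; exact: joint_reduction_at_powers.
(* For [k = 1] the vanishing is the joint reduction equation of [(a, b)] itself. *)
- move=> /(_ 1%N isT)/zeroM E; exists a, b; split=> //.
  exact/joint_reduction_atE.
Qed.
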